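(* Let $(B,+,\circ)$ and $(C,+',\circ')$ be two left $RG$-semibraces. Let $\sigma:(C,\circ')\to \mathrm{Aut}(B,+,\circ)$, $u\mapsto\sigma_u$, be a semigroup homomorphism. Then $B\times C$ endowed with the operations $$(a,u)\,\hat{+}\,(b,v):=(a+b,\;u+'v),\qquad (a,u)\,\hat{\circ}\,(b,v):=\left(a\circ\sigma_u(b),\;u\circ' v\right),$$ for all $(a,u),(b,v)\in B\times C$, is a left $RG$-semibrace.
   Context: A right group is a non-empty semigroup $(S,\cdot)$ such that for all $a,b\in S$ there is a unique $x\in S$ with $a\cdot x=b$. A left $RG$-semibrace is a triplet $(B,+,\circ)$ where $+,\circ$ are binary operations on the set $B$ such that $(B,+)$ and $(B,\circ)$ are both right groups and $a\circ(b+c)=a\circ b+(-a+a\circ c)$ for all $a,b,c\in B$, where $-a+a\circ c$ denotes the unique $x\in B$ such that $a+x=a\circ c$. $\mathrm{Aut}(B,+,\circ)$ is the group (under composition) of bijections $B\to B$ preserving both $+$ and $\circ$. *)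

(* Defs.v *)
From mathcomp Require Import all_boot.

Set Implicit Arguments.
Unset Strict Implicit.
Unset Printing Implicit Defensive.

Record right_group (S : Type) (op : S -> S -> S) : Prop := RightGroup {
  rg_inhabited : inhabited S;
  rg_assoc : associative op;
  rg_solve : forall a b : S, exists! x : S, op a x = b
}.

(* The term -a + a o c is the unique [x] with [add a x = mul a c]: such an
   [x] exists and is unique by [rg_solve lrg_add], so that the law below is the
   identity a o (b + c) = a o b + (-a + a o c) with this definite
   description written out. *)
Record left_RG_semibrace (B : Type) (add mul : B -> B -> B) : Prop :=
  LeftRGSemibrace {
  lrg_add : right_group add;
  lrg_mul : right_group mul;
  lrg_law : forall a b c x : B,
    add a x = mul a c -> mul a (add b c) = add (mul a b) x
}.

Record semibrace_aut (B : Type) (add mul : B -> B -> B) (f : B -> B) : Prop :=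
  SemibraceAut {
  aut_bij : bijective f;
  aut_add : {morph f : x y / add x y};
  aut_mul : {morph f : x y / mul x y}
}.

(* Homomorphism from (C, mulC) to Aut(B, addB, mulB), whose group law is
   [(f, g) |-> f \o g]; maps are compared extensionally. *)
Record aut_action (B C : Type) (addB mulB : B -> B -> B) (mulC : C -> C -> C)
    (sigma : C -> B -> B) : Prop := AutAction {
  act_aut : forall u : C, semibrace_aut addB mulB (sigma u);
  act_morph : forall u v : C, sigma (mulC u v) =1 sigma u \o sigma v
}.

Definition prod_add (B C : Type) (addB : B -> B -> B) (addC : C -> C -> C)
    (p q : B * C) : B * C :=
  (addB p.1 q.1, addC p.2 q.2).

Definition sdprod_mul (B C : Type) (mulB : B -> B -> B) (mulC : C -> C -> C)
    (sigma : C -> B -> B) (p q : B * C) : B * C :=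
  (mulB p.1 (sigma p.2 q.1), mulC p.2 q.2).

(* Main.v *)
Require Import Defs.
From mathcomp Require Import all_boot.

(** A semidirect product of right groups is a right group: associativity uses
    that [sigma] is an action by endomorphisms, and [(a, u) * (x, y) = (b, v)]
    is solved by dividing in each component and then undoing the bijection
    [sigma u] ([right_group_sdprod]).  This gives the multiplicative structure
    and, for the trivial action, the additive one.

    The compatibility law holds componentwise.  In the component of [B] it is
    the law of [B] at [a], [sigma u b], [sigma u c], because [sigma u] is
    additive; the element [-a + a o c] is also computed componentwise, since an
    equation in the direct sum is a pair of equations. *)

Lemma right_group_sdprod (B C : Type) (opB : B -> B -> B) (opC : C -> C -> C)
    (sigma : C -> B -> B) :
  right_group opB -> right_group opC ->
  (forall u, bijective (sigma u)) ->
  (forall u, {morph sigma u : x y / opB x y}) ->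
  (forall u v, sigma (opC u v) =1 sigma u \o sigma v) ->
  right_group (sdprod_mul opB opC sigma).
Proof.
move=> [[b0] assocB solveB] [[c0] assocC solveC] sig_bij sigM sigA.
split.
- exact: inhabits (b0, c0).
- move=> [a u] [b v] [c w]; rewrite /sdprod_mul /=.
  by rewrite sigM sigA assocB assocC.
- move=> [a u] [b v].
  have [x [ax_b x_uniq]] := solveB a b.
  have [y [uy_v y_uniq]] := solveC u v.
  have [tau sigK tauK] := sig_bij u.
  exists (tau x, y); split; first by rewrite /sdprod_mul /= tauK ax_b uy_v.
  move=> [x' y'] [/x_uniq -> /y_uniq ->].
  by rewrite sigK.
Qed.

Theorem theorem2p9 (B C : Type)
    (addB mulB : B -> B -> B) (addC mulC : C -> C -> C)
    (hB : left_RG_semibrace addB mulB)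
    (hC : left_RG_semibrace addC mulC)
    (sigma : C -> B -> B)
    (hsigma : aut_action addB mulB mulC sigma) :
  left_RG_semibrace (prod_add addB addC) (sdprod_mul mulB mulC sigma).
Proof.
case: hB hC hsigma => [addBP mulBP lawB] [addCP mulCP lawC] [sig_aut sigA].
split.
- (* The direct sum is the semidirect product for the trivial action. *)
  by apply: (@right_group_sdprod _ _ _ _ (fun _ => id)) => // _; exists id.
- by apply: right_group_sdprod => // u; case: (sig_aut u).
- move=> [a u] [b v] [c w] [x z] [ax_ac uz_uw].
  rewrite /prod_add /sdprod_mul /= (aut_add (sig_aut u)).
  by rewrite (lawB _ _ _ _ ax_ac) (lawC _ _ _ _ uz_uw).
Qed.
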